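(* Let $G$ be a finite simple graph. For every edge $e\in E(G)$ and every integer $\ell$ with $0\le\ell\le|V(G)|$, \[ -2\le Z^+_{(\ell)}(G)-Z^+_{(\ell)}(G-e)\le 2 \qquad\text{and}\qquad -2\le Z_{(\ell)}(G)-Z_{(\ell)}(G-e)\le 2 . \]
   Context: All graphs are finite and simple. $G-e$ is the graph obtained from $G$ by deleting the edge $e$ (keeping all vertices). Color-change rules on a graph $X$ with current blue set $B$ (all other vertices white). PSD rule: if $C$ is the vertex set of a connected component of $X-B$, a blue vertex $x\in B$ may force $y\in C$ (turn $y$ blue) when $N_X(x)\cap C=\{y\}$. Standard rule: the same with $C$ replaced by the full white set $V(X)\setminus B$. Forces are applied one after another, with the blue set (and the white components) updated after each force. A leak is a vertex forbidden to perform a force. A set $B\subseteq V(X)$ is an $\ell$-leaky PSD forcing set (resp. $\ell$-leaky standard forcing set) of $X$ if for every $L\subseteq V(X)$ with $|L|=\ell$ there is, starting from the initial blue set $B$, a sequence of PSD (resp. standard) forces, none performed by a vertex of $L$, after which all vertices are blue. $Z^+_{(\ell)}(X)$ (resp. $Z_{(\ell)}(X)$) is the minimum size of such a set, where $0\le\ell\le|V(X)|$. *)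

(* Defs.v *)
From mathcomp Require Import all_boot.

Set Implicit Arguments.
Unset Strict Implicit.
Unset Printing Implicit Defensive.

(* A finite simple graph is a symmetric irreflexive relation
   [e : rel T] on a finType [T] of vertices. *)
Section LeakyForcing.

Variable T : finType.
Implicit Types (e : rel T) (B C L W : {set T}) (x y u v w z : T).

Definition del_edge e u v : rel T :=
  [rel x y | e x y && ([set x; y] != [set u; v])].

Definition neighbors e x : {set T} := [set y | e x y].

Definition induced e W : rel T := [rel x y | [&& x \in W, y \in W & e x y]].

Definition components e W : {set {set T}} :=
  [set [set z in W | connect (induced e W) w z] | w in W].

(* A colour-change rule: [rule B x y] means that, when the blue set is [B],
   the vertex [x] may force [y]. *)
Definition color_rule := {set T} -> rel T.

Definition psd_rule e : color_rule := fun B x y =>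
  (x \in B) && [exists C in components e (~: B), neighbors e x :&: C == [set y]].

Definition std_rule e : color_rule := fun B x y =>
  (x \in B) && (neighbors e x :&: ~: B == [set y]).

Definition force_step (rule : color_rule) L : rel {set T} :=
  [rel B B' | [exists x, exists y,
     [&& x \notin L, rule B x y & B' == y |: B]]].

(* [connect] is taken in the graph of blue sets, so it says that some finite
   sequence of forces avoiding the leaks [L] leads from [B] to all-blue. *)
Definition leaky_forcing_set (rule : color_rule) (l : nat) B : bool :=
  [forall L : {set T}, (#|L| == l) ==> connect (force_step rule L) B [set: T]].

Lemma leaky_forcing_setT rule l : leaky_forcing_set rule l [set: T].
Proof. by apply/forallP => L; apply/implyP => _; apply: connect0. Qed.

(* By [leaky_forcing_setT] the default value of the arg min is admissible, so
   this is a genuine minimum. *)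
Definition leaky_number (rule : color_rule) (l : nat) : nat :=
  #|[arg min_(B < [set: T] | leaky_forcing_set rule l B) #|B|]|.

Definition leaky_psd_number e (l : nat) : nat := leaky_number (psd_rule e) l.

Definition leaky_std_number e (l : nat) : nat := leaky_number (std_rule e) l.

End LeakyForcing.

(* Main.v *)
(* Once both ends [u], [v] of the edge are blue, [e] and [del_edge e u v] have
   the same white components and the same white neighbourhoods, so both
   colour-change rules coincide from then on.  As extra blue vertices never
   obstruct a force, adding [u] and [v] to a leaky forcing set of either graph
   gives a leaky forcing set of the other. *)
Require Import Defs.
From mathcomp Require Import all_boot all_order all_algebra.
From mathcomp Require Import zify.

Import Order.TTheory GRing.Theory Num.Theory.

Local Open Scope ring_scope.

(** The guard [y \notin B'] is essential, since neither colour-change rule ever forces a vertex that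
    is already blue. *)
Definition monotone_rule (T : finType) (rule : color_rule T) :=
  forall (B B' : {set T}) (x y : T),
    B \subset B' -> y \notin B' -> rule B x y -> rule B' x y.

Definition agree_above (T : finType) (S : {set T}) (r1 r2 : color_rule T) :=
  forall B : {set T}, S \subset B -> r1 B =2 r2 B.

Lemma agree_above_sym (T : finType) (S : {set T}) (r1 r2 : color_rule T) :
  agree_above T S r1 r2 -> agree_above T S r2 r1.
Proof. by move=> H B sB x y; rewrite H. Qed.

(** The forces made from [B] are replayed in the same order from [B'], skipping each one whose
    target is already blue. Throughout, the replayed blue set contains both the original one and
    [S], so monotonicity keeps the force valid for [r1] and agreement transfers it to [r2]. The
    forcing vertices are the same, so the leaks are respected. *)
Lemma forcing_superset (T : finType) (S L B B' : {set T})
    (r1 r2 : color_rule T) :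
  monotone_rule T r1 -> agree_above T S r1 r2 ->
  B \subset B' -> S \subset B' ->
  connect (force_step r1 L) B [set: T] -> connect (force_step r2 L) B' [set: T].
Proof.
move=> mono agr sBB' sSB' /connectP[p].
elim: p B B' sBB' sSB' => [|B1 p IHp] B B' sBB' sSB' /=.
  by move=> _ defB; move: sBB'; rewrite -defB subTset => /eqP->.
case/andP=> /existsP[x /existsP[y /and3P[xL rxy /eqP->]]] p_path p_last.
have [yB' | yB'] := boolP (y \in B').
  by apply: (IHp _ B' _ sSB' p_path p_last); rewrite subUset sub1set yB'.
apply: (@connect_trans _ _ (y |: B')).
  apply: connect1; apply/existsP; exists x; apply/existsP; exists y.
  by rewrite xL eqxx -agr // (mono B).
apply: (IHp _ _ _ _ p_path p_last); first exact: setUS.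
exact: subset_trans sSB' (subsetUr _ _).
Qed.

Lemma leaky_number_agree (T : finType) (S : {set T}) (r1 r2 : color_rule T)
    (l : nat) :
  monotone_rule T r1 -> agree_above T S r1 r2 ->
  (leaky_number r2 l <= leaky_number r1 l + #|S|)%N.
Proof.
move=> mono agr; rewrite /leaky_number.
case: arg_minnP => [|B2 _ B2min]; first exact: leaky_forcing_setT.
case: arg_minnP => [|B1 B1forcing _]; first exact: leaky_forcing_setT.
have /B2min B2le : leaky_forcing_set r2 l (B1 :|: S).
  apply/forallP => L; apply/implyP => cardL.
  move/forallP/(_ L)/implyP/(_ cardL): B1forcing.
  exact: forcing_superset mono agr (subsetUl _ _) (subsetUr _ _).
exact: leq_trans B2le (leq_card_setU _ _).
Qed.

Lemma std_rule_monotone (T : finType) (e : rel T) :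
  monotone_rule T (std_rule e).
Proof.
move=> B B' x y sBB' yB' /andP[xB /eqP Nx].
rewrite /std_rule (subsetP sBB') //= eqEsubset sub1set inE -{1}Nx.
rewrite setIS ?setCS //= in_setC yB' andbT.
by have := set11 y; rewrite -Nx inE => /andP[].
Qed.

(** Enlarging the blue set can only split or shrink white components, so the component that still
    contains [y] offers [x] no new neighbour. *)
Lemma psd_rule_monotone (T : finType) (e : rel T) :
  monotone_rule T (psd_rule e).
Proof.
move=> B B' x y sBB' yB' /andP[xB /existsP[_ /andP[/imsetP[w _ ->] /eqP Nx]]].
rewrite /psd_rule (subsetP sBB') //=.
have: y \in neighbors e x :&:
    [set z in ~: B | connect (induced e (~: B)) w z].
  by rewrite Nx set11.
rewrite !inE => /and3P[exy _ wy].
(* The old representative [w] may be blue by now, so the new component is taken around [y]. *)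
apply/existsP; exists [set z in ~: B' | connect (induced e (~: B')) y z].
rewrite imset_f ?inE //=; apply/eqP/setP => z; rewrite in_set1.
apply/idP/eqP => [|->]; last by rewrite !inE exy yB' connect0.
(* Such a [z] lies in the old component of [w], by a path through [y], and there [y] is the only
   neighbour of [x]. *)
rewrite !inE => /and3P[exz zB' yz]; apply/set1P; rewrite -Nx !inE exz /=.
rewrite (contra (subsetP sBB' z)) //=; apply: connect_trans wy _.
apply: connect_sub yz => a b /and3P[aB' bB' eab]; apply: connect1.
by apply/and3P; split=> //; [move: aB' | move: bB'];
  rewrite !inE; apply/contra/(subsetP sBB').
Qed.

(** The deleted edge has both ends blue, so it is never incident to a white vertex. *)
Lemma del_edge_white (T : finType) (e : rel T) (u v x z : T) (B : {set T}) :
  [set u; v] \subset B -> z \notin B -> del_edge e u v x z = e x z.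
Proof.
move=> sB zB; rewrite /del_edge /= andb_idr // => _.
by apply: contraNneq zB => eq_xz; rewrite (subsetP sB) // -eq_xz set22.
Qed.

Lemma neighbors_del_edge (T : finType) (e : rel T) (u v x : T)
    (B C : {set T}) :
  [set u; v] \subset B -> C \subset ~: B ->
  neighbors (del_edge e u v) x :&: C = neighbors e x :&: C.
Proof.
move=> sB sC; apply/setP => z; rewrite !in_setI.
have [/(subsetP sC) | _] := boolP (z \in C); last by rewrite !andbF.
by rewrite !andbT in_setC => zB; rewrite !in_set (del_edge_white _ _ _ _ _ _ B).
Qed.

Lemma components_del_edge (T : finType) (e : rel T) (u v : T) (B : {set T}) :
  [set u; v] \subset B ->
  components (del_edge e u v) (~: B) = components e (~: B).
Proof.
move=> sB; apply: eq_imset => w; apply/setP => z; rewrite !in_set.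
congr (_ && _); apply: eq_connect => a b; rewrite /induced /= !in_setC.
(* A blue [b] has no induced edge in either graph; a white [b] is not an end of the deleted edge. *)
by case: (boolP (b \in B)) => bB; rewrite ?andbF ?(del_edge_white _ _ _ _ _ _ B).
Qed.

Lemma std_rule_del_edge (T : finType) (e : rel T) (u v : T) :
  agree_above T [set u; v] (std_rule e) (std_rule (del_edge e u v)).
Proof.
by move=> B sB x y; rewrite /std_rule (neighbors_del_edge _ _ _ _ _ B).
Qed.

Lemma psd_rule_del_edge (T : finType) (e : rel T) (u v : T) :
  agree_above T [set u; v] (psd_rule e) (psd_rule (del_edge e u v)).
Proof.
move=> B sB x y; rewrite /psd_rule components_del_edge //; congr (_ && _).
apply: eq_existsb => C; apply: andb_id2l => /imsetP[w _ ->].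
by rewrite (neighbors_del_edge _ _ _ _ _ B) //; apply/subsetP => z /setIdP[].
Qed.

Lemma leaky_number_dist (T : finType) (u v : T) (r1 r2 : color_rule T)
    (l : nat) :
  monotone_rule T r1 -> monotone_rule T r2 ->
  agree_above T [set u; v] r1 r2 ->
  - 2%:Z <= (leaky_number r1 l)%:Z - (leaky_number r2 l)%:Z <= 2%:Z.
Proof.
move=> mono1 mono2 agr.
have le21 := leaky_number_agree _ _ _ _ l mono1 agr.
have le12 := leaky_number_agree _ _ _ _ l mono2 (agree_above_sym _ _ _ _ agr).
(* The constant 2 is the cost of adding both ends of the edge, paid once in each direction. *)
have : (#|[set u; v]| <= 2)%N by rewrite cards2; case: (u != v).
by move: le21 le12; lia.
Qed.

Theorem corollary4 (T : finType) (e : rel T)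
    (e_sym : symmetric e) (e_irr : irreflexive e)
    (u v : T) (uv_edge : e u v) (l : nat) (l_le : (l <= #|T|)%N) :
  (- 2%:Z <= (leaky_psd_number e l)%:Z
             - (leaky_psd_number (del_edge e u v) l)%:Z <= 2%:Z)
  /\
  (- 2%:Z <= (leaky_std_number e l)%:Z
             - (leaky_std_number (del_edge e u v) l)%:Z <= 2%:Z).
Proof.
split; apply: (leaky_number_dist _ u v).
- exact: psd_rule_monotone.
- exact: psd_rule_monotone.
- exact: psd_rule_del_edge.
- exact: std_rule_monotone.
- exact: std_rule_monotone.
- exact: std_rule_del_edge.
Qed.
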